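(* Let the finite element spaces $W_H$ and $V_h$ be fixed (i.e. $h$ and $H$ are fixed). Assume that there exists a unique pair of elements $\bar u_H\in W_H$ and $\bar u_h\in V_h$ such that $$(\nabla \bar u_H,\nabla\psi_H)+(f(\bar u_H),\psi_H)=0\quad\text{for all }\psi_H\in W_H$$ and $$(\nabla \bar u_h,\nabla\phi_h)+(f(\bar u_h),\phi_h)=0\quad\text{for all }\phi_h\in V_h .$$ Let $(u_H^k)_k\subset W_H$, $(\tilde u_h^k)_k\subset V_h$, $(z_h^k)_k\subset V_h$ and $u_h^k=\tilde u_h^k+z_h^k$ be sequences produced by the bi-grid scheme: for $k=0,1,\dots$, (1) $u_H^{k+1}\in W_H$ satisfies $$\Big(\frac{u_H^{k+1}-u_H^k}{\Delta t},\psi_H\Big)+(\nabla u_H^{k+1},\nabla\psi_H)+(DF(u_H^{k+1},u_H^k),\psi_H)=0\quad\text{for all }\psi_H\in W_H;$$ (2) $\tilde u_h^{k+1}\in V_h$ satisfies $(\tilde u_h^{k+1},\phi_h)-(u_H^{k+1},\phi_h)=0$ for all $\phi_h\in V_h$; (3) $z_h^{k+1}\in V_h$ satisfies, for all $\phi_h\in V_h$, $$(1+\tau\Delta t)(z_h^{k+1}-z_h^k,\phi_h)+\Delta t(\nabla z_h^{k+1},\nabla\phi_h)+\Delta t(\nabla\tilde u_h^{k+1},\nabla\phi_h)+(\tilde u_h^{k+1}-\tilde u_h^k,\phi_h)+\Delta t\,(f(u_h^k),\phi_h)=0;$$ (4) $u_h^{k+1}=\tilde u_h^{k+1}+z_h^{k+1}$.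 Assume that $\lim_{k\to+\infty}u_H^k=\bar u_H$ and that $(z_h^k)_k$ converges to some $\bar z_h$. Then $$\lim_{k\to+\infty}u_h^k=\bar u_h .$$
   Context: $\Omega\subset\mathbb{R}^n$ is a bounded open set and $(\cdot,\cdot)$ is the $L^2(\Omega)$ scalar product. $W_H$ (coarse) and $V_h$ (fine) are finite-dimensional finite element spaces of continuous functions on $\overline\Omega$ contained in $H^1(\Omega)$, with $\dim(W_H)<\dim(V_h)$; $W_H\subset V_h$ is not required. The time step is $\Delta t>0$ and $\tau>0$ is the stabilization parameter. $f:\mathbb{R}\to\mathbb{R}$ is the (differentiable) derivative $f=F'$ of a potential $F$ (typically $f(u)=u(u^2-1)$; the factor $1/\varepsilon^2$ in front of the nonlinearity in the Allen-Cahn equation is absorbed in $f$ and $F$), and $$DF(u,v)=\begin{cases}\dfrac{F(u)-F(v)}{u-v} & \text{if } u\ne v,\\ f(u) & \text{if } u=v.\end{cases}$$ *)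

(* Defs.v *)
From HB Require Import structures.
From mathcomp Require Import all_boot all_order all_algebra.
From mathcomp Require Import all_classical all_reals all_analysis.

Set Implicit Arguments.
Unset Strict Implicit.
Unset Printing Implicit Defensive.
Import Order.TTheory GRing.Theory Num.Theory.
Import numFieldTopology.Exports numFieldNormedType.Exports.

Local Open Scope classical_set_scope.
Local Open Scope ring_scope.

(* 'rV[R]_n carries the product of the Borel sigma-algebras of the coordinates,
   as n.-tuple does in the library. *)
Section measurable_rV.
Variables (R : realType) (n : nat).

Let coord (i : 'I_n) (x : 'rV[R]_n) : measurableTypeR R := x ord0 i.

Let rV_set0 : g_sigma_preimage coord set0.
Proof. exact: sigma_algebra0. Qed.

Let rV_setC A : g_sigma_preimage coord A -> g_sigma_preimage coord (~` A).
Proof. exact: sigma_algebraC. Qed.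

Let rV_bigcup (F : (set 'rV[R]_n)^nat) :
  (forall i, g_sigma_preimage coord (F i)) ->
  g_sigma_preimage coord (\bigcup_i (F i)).
Proof. exact: sigma_algebra_bigcup. Qed.

Fact rV_display : measure_display. Proof. exact. Qed.

HB.instance Definition _ := @isMeasurable.Build rV_display
  'rV[R]_n (g_sigma_preimage coord) rV_set0 rV_setC rV_bigcup.

End measurable_rV.

Section lebesgue_rV.
Variable R : realType.

Definition rV_cons n (p : measurableTypeR R * 'rV[R]_n) : 'rV[R]_n.+1 :=
  \row_i (if unlift ord0 i is Some j then p.2 ord0 j else p.1).

Definition rV_uncons n (x : 'rV[R]_n.+1) : measurableTypeR R * 'rV[R]_n :=
  (x ord0 ord0, \row_i x ord0 (lift ord0 i)).

Lemma rV_consK n : cancel (@rV_cons n) (@rV_uncons n).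
Proof.
move=> [t y]; rewrite /rV_uncons mxE unlift_none; congr pair.
by apply/rowP => i; rewrite !mxE liftK.
Qed.

Lemma rV_unconsK n : cancel (@rV_uncons n) (@rV_cons n).
Proof.
by move=> x; apply/rowP => j; rewrite mxE; case: unliftP => [k|] -> //=;
  rewrite mxE.
Qed.

Lemma measurable_rV_coord n (i : 'I_n) :
  measurable_fun [set: 'rV[R]_n] (fun x => x ord0 i : measurableTypeR R).
Proof.
move=> _ Y mY; rewrite setTI; apply: sub_sigma_algebra => /=.
rewrite -bigcup_seq/=; exists i => /=; first by rewrite mem_index_enum.
by exists Y => //; rewrite setTI.
Qed.

Lemma measurable_fun_rV d (T : measurableType d) n (f : T -> 'rV[R]_n) :
  (forall i, measurable_fun [set: T] (fun t => f t ord0 i : measurableTypeR R)) ->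
  measurable_fun [set: T] f.
Proof.
move=> mf _ Y mY; rewrite setTI.
have : measurable `<=` [set A : set 'rV[R]_n | measurable (f @^-1` A)].
  apply: smallest_sub.
    split => /=.
    - by rewrite preimage_set0.
    - by move=> A mA; rewrite setTD -preimage_setC; exact: measurableC.
    - by move=> F mF; rewrite preimage_bigcup; exact: bigcup_measurable.
  rewrite -bigcup_seq/=; apply: bigcup_sub => i _ A [B mB <-] /=.
  by rewrite !setTI -comp_preimage -[X in measurable X]setTI; exact: mf.
exact.
Qed.

Lemma measurable_rV_cons n : measurable_fun setT (@rV_cons n).
Proof.
apply: measurable_fun_rV => i.
case: (unliftP ord0 i) => [k|] ->.
  rewrite (_ : (fun _ => _) = (fun y : 'rV[R]_n => y ord0 k) \o snd).
    exact: measurableT_comp (measurable_rV_coord k) measurable_snd.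
  by apply/funext => -[t y]; rewrite mxE liftK.
rewrite (_ : (fun _ => _) = fst) //.
by apply/funext => -[t y]; rewrite mxE unlift_none.
Qed.

Lemma measurable_rV_uncons n : measurable_fun setT (@rV_uncons n).
Proof.
apply: measurable_fun_pair; first exact: measurable_rV_coord.
apply: measurable_fun_rV => i.
rewrite (_ : (fun _ => _) = (fun x : 'rV[R]_n.+1 => x ord0 (lift ord0 i))).
  exact: measurable_rV_coord.
by apply/funext => x; rewrite mxE.
Qed.

(* n-dimensional Lebesgue measure, as an iterated product of the
   one-dimensional one: the point mass for n = 0, then
   |A| = \int |{y : (t, y) \in A}| dt. *)
Fixpoint lebesgue_rV n : set 'rV[R]_n -> \bar R :=
  match n with
  | 0 => @dirac _ 'rV[R]_0 0 R
  | m.+1 => pushforward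
      (product_measure1 (@lebesgue_measure R) (@lebesgue_rV m)) (@rV_cons m)
  end.

Lemma sigma_finite_pushforward_cons n
    (m : {sigma_finite_measure set (measurableTypeR R) -> \bar R})
    (mu : {sigma_finite_measure set 'rV[R]_n -> \bar R}) :
  sigma_finite setT (pushforward (product_measure1 m mu) (@rV_cons n)).
Proof.
have /sigma_finiteP[F [TF ndF Foo]] := sigma_finiteT m.
have /sigma_finiteP[G [TG ndG Goo]] := sigma_finiteT mu.
exists (fun k => @rV_uncons n @^-1` (F k `*` G k)).
  apply/seteqP; split => // x _.
  have [i _ Fi] : (\bigcup_i F i) (rV_uncons x).1 by rewrite -TF.
  have [j _ Gj] : (\bigcup_i G i) (rV_uncons x).2 by rewrite -TG.
  exists (maxn i j) => //; split.
    by move: Fi; exact/subsetPset/ndF/leq_maxl.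
  by move: Gj; exact/subsetPset/ndG/leq_maxr.
move=> k; have [mF Fk] := Foo k; have [mG Gk] := Goo k; split.
  by rewrite -[X in measurable X]setTI; apply: measurable_rV_uncons => //;
    exact: measurableX.
rewrite /pushforward -comp_preimage (_ : _ \o _ = id); last first.
  by apply/funext => p /=; exact: rV_consK.
by rewrite preimage_id product_measure1E// lte_mul_pinfty// ge0_fin_numE.
Qed.

Let pack_sigma_finite_measure d (T : measurableType d) (m : set T -> \bar R) :
    m set0 = 0%E -> (forall A, (0 <= m A)%E) -> semi_sigma_additive m ->
    sigma_finite setT m ->
  exists mu : {sigma_finite_measure set T -> \bar R}, m = mu.
Proof.
move=> m0 mge0 madd ms.
pose mM : {measure set T -> \bar R} :=
  HB.pack m (isMeasure.Build _ _ _ m m0 mge0 madd).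
pose mS : {sigma_finite_measure set T -> \bar R} :=
  HB.pack (Measure.sort mM) (Measure_isSigmaFinite.Build _ _ _ mM ms).
by exists mS.
Qed.

Let lebesgue_rV_measure n :
  exists mu : {sigma_finite_measure set 'rV[R]_n -> \bar R},
    @lebesgue_rV n = mu.
Proof.
elim: n => [|n [mu IH]]; first by exists (@dirac _ 'rV[R]_0 0 R).
have mc := @measurable_rV_cons n.
rewrite /= IH; apply: pack_sigma_finite_measure.
- exact: measure0.
- by move=> A; exact: measure_ge0.
- exact: measure_semi_sigma_additive.
- exact: sigma_finite_pushforward_cons.
Qed.

Section instance.
Variable n : nat.

Let leb0 : @lebesgue_rV n set0 = 0%E.
Proof. by have [mu ->] := lebesgue_rV_measure n; exact: measure0. Qed.

Let leb_ge0 A : (0 <= @lebesgue_rV n A)%E.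
Proof. by have [mu ->] := lebesgue_rV_measure n; exact: measure_ge0. Qed.

Let leb_sigma_additive : semi_sigma_additive (@lebesgue_rV n).
Proof.
have [mu ->] := lebesgue_rV_measure n; exact: measure_semi_sigma_additive.
Qed.

HB.instance Definition _ := isMeasure.Build _ _ _ (@lebesgue_rV n)
  leb0 leb_ge0 leb_sigma_additive.

Let leb_sigma_finite : sigma_finite setT (@lebesgue_rV n).
Proof. by have [mu ->] := lebesgue_rV_measure n; exact: sigma_finiteT. Qed.

HB.instance Definition _ := Measure_isSigmaFinite.Build _ _ _ (@lebesgue_rV n)
  leb_sigma_finite.

End instance.
End lebesgue_rV.

Section sobolev.
Variables (R : realType) (n : nat).
Notation E := 'rV[R]_n.
Implicit Types (Omega : set E) (u v phi : E -> R) (g h : E -> E).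

(* Functions on Omega or on its closure are represented by total functions
   whose values elsewhere are irrelevant; this is their equality. *)
Definition agree (A : set E) u v := forall x, A x -> u x = v x.

Definition L2 Omega u : Prop :=
  measurable_fun Omega u /\
  (@lebesgue_rV R n).-integrable Omega (fun x => (u x ^+ 2)%:E).

Definition dotL2 Omega u v : R :=
  \int[@lebesgue_rV R n]_(x in Omega) (u x * v x).

Definition normL2 Omega u : R := Num.sqrt (dotL2 Omega u u).

Definition dotL2_vec Omega g h : R :=
  \int[@lebesgue_rV R n]_(x in Omega) (\sum_(i < n) g x ord0 i * h x ord0 i).

Definition partial (i : 'I_n) phi : E -> R :=
  fun x => 'D_(delta_mx ord0 i) phi x.

Definition smooth phi : Prop :=
  forall (s : seq 'I_n) (x : E), differentiable (foldr partial phi s) x.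

(* C_c^oo(Omega); phi is extended by 0 outside of Omega. *)
Definition test_function Omega phi : Prop :=
  smooth phi /\
  exists K : set E,
    [/\ compact K, K `<=` Omega & forall x, ~ K x -> phi x = 0].

(* g is a version of the distributional gradient of u, with components in
   L^2(Omega). Versions agree almost everywhere, so integrals involving g do
   not depend on which one is taken. *)
Definition weak_gradient Omega u g : Prop :=
  (forall i, L2 Omega (fun x => g x ord0 i)) /\
  forall phi, test_function Omega phi -> forall i,
    dotL2 Omega u (partial i phi) = - dotL2 Omega (fun x => g x ord0 i) phi.

Definition H1 Omega u : Prop := L2 Omega u /\ exists g, weak_gradient Omega u g.

(* V is closed under agreement on the closure of Omega, and N is its dimension
   modulo that agreement. *)
Record fe_space Omega (N : nat) (V : set (E -> R)) : Prop := FESpace {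
  fe_continuous : forall u, V u -> {within closure Omega, continuous u};
  fe_H1 : forall u, V u -> H1 Omega u;
  fe_basis : exists b : 'I_N -> E -> R,
    (forall c : 'I_N -> R,
       agree (closure Omega) (fun x => \sum_i c i * b i x) (fun=> 0) ->
       forall i, c i = 0) /\
    (forall u, V u <-> exists c : 'I_N -> R,
       agree (closure Omega) u (fun x => \sum_i c i * b i x))
}.

Definition cvgL2 Omega (u : nat -> E -> R) v : Prop :=
  (fun k => normL2 Omega (u k \- v)) @ \oo --> (0 : R).

Variables (f F : R -> R).

Definition DF (a b : R) : R := if a == b then f a else (F a - F b) / (a - b).

Definition stationary Omega (V : set (E -> R)) u : Prop :=
  V u /\
  forall psi, V psi ->
  forall gu gpsi, weak_gradient Omega u gu -> weak_gradient Omega psi gpsi ->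
    dotL2_vec Omega gu gpsi + dotL2 Omega (fun x => f (u x)) psi = 0.

Record bigrid_scheme Omega (W V : set (E -> R)) (dt tau : R)
    (uH ut z u : nat -> E -> R) : Prop := BigridScheme {
  bigrid_uH_in : forall k, W (uH k);
  bigrid_ut_in : forall k, V (ut k);
  bigrid_z_in : forall k, V (z k);
  bigrid_u : forall k, agree (closure Omega) (u k) (ut k \+ z k);
  bigrid_coarse : forall k psi, W psi ->
    forall gu gpsi,
      weak_gradient Omega (uH k.+1) gu -> weak_gradient Omega psi gpsi ->
    dotL2 Omega (fun x => (uH k.+1 x - uH k x) / dt) psi
    + dotL2_vec Omega gu gpsi
    + dotL2 Omega (fun x => DF (uH k.+1 x) (uH k x)) psi = 0;
  bigrid_prolongation : forall k phi, V phi ->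
    dotL2 Omega (ut k.+1) phi - dotL2 Omega (uH k.+1) phi = 0;
  bigrid_correction : forall k phi, V phi ->
    forall gz gt gphi,
      weak_gradient Omega (z k.+1) gz -> weak_gradient Omega (ut k.+1) gt ->
      weak_gradient Omega phi gphi ->
    (1 + tau * dt) * dotL2 Omega (z k.+1 \- z k) phi
    + dt * dotL2_vec Omega gz gphi
    + dt * dotL2_vec Omega gt gphi
    + dotL2 Omega (ut k.+1 \- ut k) phi
    + dt * dotL2 Omega (fun x => f (u k x)) phi = 0
}.

End sobolev.

(* Main.v *)
Require Import Defs.
From mathcomp Require Import all_boot all_order all_algebra.
From mathcomp Require Import all_classical all_reals all_analysis.
From mathcomp Require Import measurable_realfun ring lra.
Import Order.TTheory GRing.Theory Num.Theory.
Import numFieldTopology.Exports numFieldNormedType.Exports.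
Local Open Scope classical_set_scope.
Local Open Scope ring_scope.

(** Everything happens in the finite-dimensional space V, where convergence in
    L^2 is convergence of the coordinates in a basis b. The limit of the scheme
    is then identified as a stationary element of V, and uniqueness of that
    element concludes.

    Coordinates. The Gram matrix of b is invertible: a combination of the b_i
    of zero L^2 norm vanishes almost everywhere on Omega, hence everywhere on
    the closure of Omega since it is continuous and balls have positive
    measure ([dotL2_self_eq0], [gram_unit]). So the coordinates of a
    sequence in V converge as soon as its scalar products with the b_i do
    ([cvg_coords]). This applies to z^k, which converges in L^2, and to
    ut^(k+1), whose scalar products with V are those of uH^(k+1), which
    converges in L^2. Hence the coordinates of uh^k = ut^k + z^k converge, to
    those of some ul in V.

    Passing to the limit. Against a fixed phi in V, each linear term of the
    correction step is a linear form in the coordinates. The increments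
    z^(k+1) - z^k and ut^(k+1) - ut^k disappear in the limit, and what remains,
    divided by dt, is (grad ul, grad phi) + (f(ul), phi) = 0. The nonlinear
    term converges by dominated convergence, because the b_i are bounded on the
    compact closure of Omega and f is bounded on bounded intervals
    ([cvg_dotL2_comp_lincomb]). Thus ul is stationary ([limit_stationary]) and
    agrees with ubarh.

    Gradients. Stationarity quantifies over all versions of the weak gradient
    of ul, while the limit computation produces a particular one, the
    combination of chosen gradients of the b_i. That both give the same scalar
    products follows from the scheme itself: the correction step holds for
    every version of the gradient of z^1, so the difference of two versions of
    a gradient, which is a weak gradient of 0 and may be added to that of z^1,
    is orthogonal to the gradients of V ([weak_gradient_version]). *)

Set Implicit Arguments.
Unset Strict Implicit.
Unset Printing Implicit Defensive.

(** * Lebesgue measure and the topology of row vectors *)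

Lemma rV_ballP (R : realType) (n : nat) (x y : 'rV[R]_n) (r : R) :
  ball x r y <-> 0 < r /\ forall i, ball (x ord0 i) r (y ord0 i).
Proof.
split=> -[r0 H]; first by split=> // i; exact: H.
by split=> // i j; rewrite (ord1 i); exact: H.
Qed.

Lemma measurable_rV_ball (R : realType) (n : nat) (x : 'rV[R]_n) (r : R) :
  measurable (ball x r).
Proof.
have [r0|r0] := ltP 0 r; last first.
  suff -> : ball x r = set0 by [].
  by apply/seteqP; split=> // y /rV_ballP[]; rewrite ltNge r0.
have -> : ball x r =
    \big[setI/setT]_(i < n) ((fun y : 'rV[R]_n => y ord0 i) @^-1` ball (x ord0 i) r).
  rewrite big_mkcond; apply/seteqP; split=> y.
    by move=> /rV_ballP[_ H]; rewrite -bigcap_seq /= => i _; exact: H.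
  rewrite -bigcap_seq /= => H; apply/rV_ballP; split=> // i.
  by apply: H => /=; rewrite mem_index_enum.
apply: bigsetI_measurable => i _; rewrite -[X in measurable X]setTI.
by apply: (@measurable_rV_coord R n i) => //; exact: open_measurable (ball_open _ _).
Qed.

(** The sigma-algebra of the row vectors is generated by the coordinates, so the
    point is that an open set is the union of countably many boxes, those with
    rational center and radius that it contains. *)
Lemma open_measurable_rV (R : realType) (n : nat) (U : set 'rV[R]_n) :
  open U -> measurable U.
Proof.
move=> oU.
(* indexing by all rational balls keeps the union over a countable type; *)
(* those not contained in U are replaced by the empty set *)
pose B (p : 'rV[rat]_n * rat) : set 'rV[R]_n :=
  ball (map_mx (@ratr R) p.1) (ratr p.2).
have -> : U = \bigcup_p (if `[< B p `<=` U >] then B p else set0).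
  apply/seteqP; split=> [x Ux|x [p _]]; last first.
    by case: asboolP => // BU /BU.
  have /nbhs_ballP[e /= e0 eU] : nbhs x U by exact: open_nbhs_nbhs.
  have [q] : exists q : rat, ratr q \in `]0, e / 2[ by apply: rat_in_itvoo; rewrite divr_gt0.
  rewrite in_itv /= => /andP[q0 qe].
  have /choice[c cP] (i : 'I_n) : exists c : rat, `|x ord0 i - ratr c| < ratr q.
    have [c] : exists c : rat, ratr c \in `]x ord0 i - ratr q, x ord0 i + ratr q[.
      by apply: rat_in_itvoo; rewrite ltrD2l gtrN.
    rewrite in_itv /= => H; exists c; rewrite distrC ltr_distl; exact: H.
  exists (\row_i c i, q) => //.
  have xB : B (\row_i c i, q) x.
    by apply/rV_ballP; split=> // i; rewrite !mxE /ball /= distrC.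
  case: asboolP => // -[] y yB; apply: eU.
  apply: (@le_ball _ _ _ (ratr q + ratr q)); first by rewrite [leRHS](splitr e) lerD// ltW.
  by apply: ball_triangle yB; exact: ball_sym.
apply: countable_bigcupT_measurable => // p; case: asboolP => // _.
exact: measurable_rV_ball.
Qed.

Lemma continuous_measurable_rV (R : realType) (n : nat) (u : 'rV[R]_n -> R)
    (D : set 'rV[R]_n) :
  continuous u -> measurable_fun D (u : _ -> measurableTypeR R).
Proof.
move=> cu; apply: (@measurable_funS _ _ _ _ setT) => //.
apply: (measurability _ (RGenOpens.measurableE R)).
move=> _ [_ [a [b ->] <-]]; rewrite setTI; apply: open_measurable_rV.
by move/continuousP: cu; apply; exact: interval_open.
Qed.

(** Balls for the sup norm are cubes, on which the iterated product measure is
    computed one coordinate at a time. *)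
Lemma lebesgue_rV_ball (R : realType) (n : nat) (x : 'rV[R]_n) (r : R) :
  0 < r -> @lebesgue_rV R n (ball x r) = ((r *+ 2) ^+ n)%:E.
Proof.
move=> r0; elim: n x => [|n IH] x.
  by rewrite expr0 /= diracE mem_set//; apply/rV_ballP; split=> // -[].
rewrite /= /pushforward.
have -> : @rV_cons R n @^-1` ball x r =
    ball (x ord0 ord0) r `*` ball (\row_i x ord0 (lift ord0 i)) r.
  apply/seteqP; split=> -[t y] /=.
    move=> /rV_ballP[_ H]; split; first by have := H ord0; rewrite mxE unlift_none.
    by apply/rV_ballP; split=> // i; have := H (lift ord0 i); rewrite !mxE liftK.
  move=> [Ht /rV_ballP[_ Hy]]; apply/rV_ballP; split=> // i; rewrite mxE.
  by case: unliftP => [j|] -> //; have := Hy j; rewrite mxE.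
rewrite product_measure1E; [|exact: open_measurable (ball_open _ _)|exact: measurable_rV_ball].
rewrite exprS EFinM; congr (_ * _)%E; last exact: IH.
exact: lebesgue_measure_ball (ltW r0).
Qed.

Lemma lebesgue_rV_bounded (R : realType) (n : nat) (D : set 'rV[R]_n) :
  measurable D -> bounded_set D -> (@lebesgue_rV R n D < +oo)%E.
Proof.
move=> mD [M [Mr MD]].
pose r := `|M| + 1; have r0 : 0 < r by rewrite ltr_wpDl.
have DB : D `<=` ball 0 (r + 1).
  move=> x Dx; rewrite mx_norm_ball /ball_ /= sub0r normrN.
  apply: (@le_lt_trans _ _ r); last by rewrite ltrDl.
  by apply: (MD r) => //; rewrite (le_lt_trans (ler_norm M))// ltrDl.
apply: (@le_lt_trans _ _ (@lebesgue_rV R n (ball 0 (r + 1)))).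
  by apply: le_measure => //; rewrite inE//; exact: measurable_rV_ball.
by rewrite lebesgue_rV_ball ?ltry// addr_gt0.
Qed.

(** * Square integrable functions *)

Section L2_theory.
Variables (R : realType) (n : nat) (D : set 'rV[R]_n).
Hypothesis mD : measurable D.
Local Notation mu := (@lebesgue_rV R n).
Implicit Types u v w : 'rV[R]_n -> R.

(** The product is dominated by the sum of the squares. *)
Lemma L2_integrableM u v :
  L2 D u -> L2 D v -> mu.-integrable D (EFin \o (fun x => u x * v x)).
Proof.
move=> [mu_ iu] [mv iv]; apply: le_integrable (integrableD mD iu iv) => //.
  by apply/measurable_EFinP; apply: measurable_funM.
move=> x Dx /=; rewrite !lee_fin normrM (@ger0_norm _ (_ + _)) ?addr_ge0 ?sqr_ge0//.
rewrite -(real_normK (num_real (u x))) -(real_normK (num_real (v x))).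
have a0 := normr_ge0 (u x); have b0 := normr_ge0 (v x).
have := sqr_ge0 (`|u x| - `|v x|); nra.
Qed.

Lemma L2_lin (a : R) u v : L2 D u -> L2 D v -> L2 D (fun x => a * u x + v x).
Proof.
move=> Lu Lv; have [mu_ iu] := Lu; have [mv iv] := Lv; split.
  by apply: measurable_funD => //; apply: measurable_funM.
have -> : (fun x => ((a * u x + v x) ^+ 2)%:E) =
    ((fun x => (a ^+ 2)%:E * (u x ^+ 2)%:E) \+
     ((fun x => (a *+ 2)%:E * (u x * v x)%:E) \+ (fun x => (v x ^+ 2)%:E)))%E.
  by apply/funext => x /=; rewrite -!EFinM -!EFinD; congr EFin; ring.
apply: (integrableD mD); first exact: integrableZl.
by apply: (integrableD mD) => //; apply: integrableZl => //; exact: L2_integrableM.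
Qed.

Lemma L2_0 : L2 D (fun=> 0).
Proof.
split; first exact: measurable_cst.
under eq_fun do rewrite expr0n /=.
exact: integrable0.
Qed.

Lemma L2_lincomb (I : Type) (s : seq I) (c : I -> R) (b : I -> 'rV[R]_n -> R) :
  (forall i, L2 D (b i)) -> L2 D (fun x => \sum_(i <- s) c i * b i x).
Proof.
move=> Lb; elim: s => [|i s IH].
  by under eq_fun do rewrite big_nil; exact: L2_0.
by under eq_fun do rewrite big_cons; exact: L2_lin.
Qed.

Lemma L2_bounded u : (mu D < +oo)%E -> measurable_fun D u ->
  (exists M, forall x, D x -> `|u x| <= M) -> L2 D u.
Proof.
move=> fD mu_ [M uM]; split => //.
apply: (@measurable_bounded_integrable _ _ _ mu (fun x => u x ^+ 2)) => //.
  exact: measurable_funX.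
exists (M ^+ 2); split; first exact: num_real.
move=> y My x Dx /=; rewrite normrX (le_trans _ (ltW My))// lerXn2r ?nnegrE//.
  exact: le_trans (uM _ Dx).
exact: uM.
Qed.

Lemma eq_L2 u v : agree D u v -> L2 D u -> L2 D v.
Proof.
move=> uv [mu_ iu]; split.
  by apply: eq_measurable_fun mu_ => x; rewrite inE => /uv.
by apply: eq_integrable iu => // x; rewrite inE => /uv ->.
Qed.

Lemma eq_dotL2 u u' v v' : agree D u u' -> agree D v v' ->
  dotL2 D u v = dotL2 D u' v'.
Proof.
by move=> uu' vv'; apply: eq_Rintegral => x; rewrite inE => Dx; rewrite uu'// vv'.
Qed.

Lemma dotL2C u v : dotL2 D u v = dotL2 D v u.
Proof. by rewrite /dotL2; under eq_fun do rewrite mulrC. Qed.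

Lemma dotL2_linl (a : R) u v w : L2 D u -> L2 D v -> L2 D w ->
  dotL2 D (fun x => a * u x + v x) w = a * dotL2 D u w + dotL2 D v w.
Proof.
move=> Lu Lv Lw; rewrite /dotL2; under eq_fun do rewrite mulrDl -mulrA.
rewrite RintegralD//; last exact: L2_integrableM.
  by rewrite RintegralZl//; exact: L2_integrableM.
exact: (integrableZl mD a (L2_integrableM Lu Lw)).
Qed.

Lemma dotL2_0l u : dotL2 D (fun=> 0) u = 0.
Proof.
by rewrite /dotL2; under eq_fun do rewrite mul0r; rewrite Rintegral_cst// mul0r.
Qed.

Lemma dotL2Bl u v w : L2 D u -> L2 D v -> L2 D w ->
  dotL2 D (u \- v) w = dotL2 D u w - dotL2 D v w.
Proof.
move=> Lu Lv Lw; rewrite addrC -mulN1r -dotL2_linl//.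
by apply: eq_dotL2 => // x _ /=; rewrite mulN1r addrC.
Qed.

Lemma L2B u v : L2 D u -> L2 D v -> L2 D (u \- v).
Proof.
move=> Lu Lv; apply: eq_L2 (L2_lin (-1) Lv Lu) => x _ /=.
by rewrite mulN1r addrC.
Qed.

Lemma dotL2_lincombl (I : Type) (s : seq I) (c : I -> R)
    (b : I -> 'rV[R]_n -> R) v : (forall i, L2 D (b i)) -> L2 D v ->
  dotL2 D (fun x => \sum_(i <- s) c i * b i x) v =
  \sum_(i <- s) c i * dotL2 D (b i) v.
Proof.
move=> Lb Lv; elim: s => [|i s IH].
  by under eq_fun do rewrite big_nil; rewrite big_nil dotL2_0l.
under eq_fun do rewrite big_cons.
by rewrite big_cons dotL2_linl// ?IH//; exact: L2_lincomb.
Qed.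

Lemma dotL2_ge0 u : 0 <= dotL2 D u u.
Proof. by apply: Rintegral_ge0 => x _; rewrite -expr2 sqr_ge0. Qed.

(** The polynomial in t given by the square norm of t u + v is nonnegative; it is
    evaluated at its minimum, or, when u has norm 0, at a point where a nonzero
    slope would make it negative. *)
Lemma cauchy_schwarz u v : L2 D u -> L2 D v ->
  dotL2 D u v ^+ 2 <= dotL2 D u u * dotL2 D v v.
Proof.
move=> Lu Lv; set a := dotL2 D u u; set b := dotL2 D u v; set c := dotL2 D v v.
have P t : 0 <= t ^+ 2 * a + t * b *+ 2 + c.
  have := dotL2_ge0 (fun x => t * u x + v x).
  rewrite dotL2_linl//; last exact: L2_lin.
  rewrite !(dotL2C _ (fun x => _ + _)) !dotL2_linl// -/a -/c (dotL2C v u) -/b.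
  by rewrite mulrDr mulrA -expr2 mulr2n !addrA.
have a_ge0 : 0 <= a := dotL2_ge0 u.
have [a0|a0] := eqVneq a 0.
  rewrite a0 mul0r; have [->|b0] := eqVneq b 0; first by rewrite expr0n.
  have := P (- (c + 1) / (b *+ 2)).
  have -> : - (c + 1) / (b *+ 2) * b *+ 2 = - (c + 1).
    by rewrite -mulrnAr divfK// mulrn_eq0.
  by rewrite a0; lra.
have := P (- b / a).
have -> : (- b / a) ^+ 2 * a + - b / a * b *+ 2 + c = (a * c - b ^+ 2) / a.
  by field.
by rewrite pmulr_lge0 ?invr_gt0 ?lt0r ?a0// subr_ge0.
Qed.

Lemma normr_dotL2_le u v : L2 D u -> L2 D v ->
  `|dotL2 D u v| <= normL2 D u * normL2 D v.
Proof.
move=> Lu Lv; rewrite -sqrtrM ?dotL2_ge0// -sqrtr_sqr.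
by rewrite ler_wsqrtr// cauchy_schwarz.
Qed.

Lemma cvgL2_dotL2 (u : nat -> 'rV[R]_n -> R) u' v :
  (forall k, L2 D (u k)) -> L2 D u' -> L2 D v -> cvgL2 D u u' ->
  dotL2 D (u k) v @[k --> \oo] --> dotL2 D u' v.
Proof.
move=> Lu Lu' Lv uu'; apply/subr_cvg0.
apply: (@squeeze_cvgr _ _ _ _ (fun k => - (normL2 D (u k \- u') * normL2 D v))
         (fun k => normL2 D (u k \- u') * normL2 D v)).
- near=> k; rewrite -ler_norml -dotL2Bl//.
  by apply: normr_dotL2_le => //; exact: L2B.
- rewrite -[X in _ --> X]oppr0 -(mul0r (normL2 D v)).
  by apply: cvgN; apply: cvgMl.
- by rewrite -(mul0r (normL2 D v)); apply: cvgMl.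
Unshelve. all: by end_near. Qed.
End L2_theory.

(** * Coordinates and L^2 convergence *)

Definition lincomb (R : realType) (n N : nat) (b : 'I_N -> 'rV[R]_n -> R)
  (c : 'I_N -> R) : 'rV[R]_n -> R := fun x => \sum_i c i * b i x.

Section finite_dim.
Variables (R : realType) (n : nat) (Omega : set 'rV[R]_n).
Hypotheses (oO : open Omega) (bO : bounded_set Omega).
Local Notation mu := (@lebesgue_rV R n).
Local Notation E := ('rV[R]_n).

Let mO : measurable Omega := open_measurable_rV oO.

(** The closure of a bounded set is bounded, hence compact. *)
Lemma continuous_closure_bounded (u : E -> R) :
  {within closure Omega, continuous u} ->
  exists M, forall x, closure Omega x -> `|u x| <= M.
Proof.
move=> cu.
have bcO : bounded_set (closure Omega).
  have [M [Mr MO]] := bO; exists M; split=> // y My.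
  have : closed [set x : E | `|x| <= y].
    have := @closed_comp _ _ (fun x : E => `|x|) [set r | r <= y].
    by apply; [move=> x _; exact: norm_continuous|exact: closed_le].
  by move=> cl x /(closure_subset (MO y My)) /cl.
have /compact_bounded[M [Mr H]] := continuous_compact cu
  (bounded_closed_compact bcO (@closed_closure _ Omega)).
exists (`|M| + 1) => x Ox; apply: (H (`|M| + 1)); last by exists x.
by rewrite (le_lt_trans (ler_norm M))// ltrDl.
Qed.

(** If u x is nonzero at a point of Omega then u is nonzero on a ball, which
    has positive measure; so u vanishes on Omega, and on its closure by
    continuity. *)
Lemma dotL2_self_eq0 (u : E -> R) : {within closure Omega, continuous u} ->
  L2 Omega u -> dotL2 Omega u u = 0 -> agree (closure Omega) u (fun=> 0).
Proof.
move=> /subspace_continuousP cu0 Lu u0.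
have cu x : closure Omega x -> u y @[y --> within (closure Omega) (nbhs x)] --> u x.
  exact: cu0.
have uO x : Omega x -> u x = 0.
  move=> Ox; apply/eqP; apply: contrapT => /negP ux0.
  have [e /= e0 eB] : exists2 e : R, 0 < e &
      ball x e `<=` [set y | Omega y /\ u y != 0].
    apply/nbhs_ballP; have := cu x (subset_closure Ox).
    move=> /(_ [set r | r != 0]) /(_ _)/wrap[].
      by apply: open_nbhs_nbhs; split => //; exact: open_neq.
    move=> H; have NO : nbhs x Omega by exact: open_nbhs_nbhs.
    near=> y; split; first by near: y.
    apply: (near (H : \forall y \near nbhs x, closure Omega y -> u y != 0) y) => //.
    by apply: subset_closure; near: y.
  have : ae_eq mu Omega (fun x => (u x * u x)%:E) (cst 0%E).
    apply/(ae_eq_integral_abs mu mO).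
      by apply/measurable_EFinP; apply: measurable_funM; have [] := Lu.
    have -> : (\int[mu]_(x in Omega) `|(u x * u x)%:E| =
               \int[mu]_(x in Omega) (u x * u x)%:E)%E.
      by apply: eq_integral => y _; rewrite gee0_abs// lee_fin -expr2 sqr_ge0.
    rewrite -[LHS]fineK; last first.
      by apply: integrable_fin_num => //; exact: L2_integrableM.
    by move: u0; rewrite /dotL2 /Rintegral => ->.
  move=> [A [mA A0 UA]].
  have : (mu (ball x e) <= mu A)%E.
    apply: le_measure; rewrite ?inE//; first exact: measurable_rV_ball.
    move=> y /eB[Oy uy]; apply: UA => /= /(_ Oy)[] /eqP.
    by rewrite mulf_eq0 orbb; exact/negP.
  by rewrite A0 leNgt lebesgue_rV_ball// lte_fin exprn_gt0// pmulrn_rgt0.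
move=> x cx; apply/eqP; apply: contrapT => /negP ux0.
have := cu x cx => /(_ [set r | r != 0]) /(_ _)/wrap[].
  by apply: open_nbhs_nbhs; split => //; exact: open_neq.
move=> /cx[y [Oy]] /(_ (subset_closure Oy)) /=.
by rewrite uO// eqxx.
Unshelve. all: by end_near.
Qed.

Lemma cvg_sum (I : Type) (s : seq I) (f : I -> nat -> R) (l : I -> R) :
  (forall i, f i k @[k --> \oo] --> l i) ->
  \sum_(i <- s) f i k @[k --> \oo] --> \sum_(i <- s) l i.
Proof.
move=> fl; elim: s => [|i s IH].
  by under eq_fun do rewrite big_nil; rewrite big_nil; exact: cvg_cst.
by under eq_fun do rewrite big_cons; rewrite big_cons; exact: cvgD.
Qed.

Variables (N : nat) (b : 'I_N -> E -> R).
Hypothesis b_cont : forall i, {within closure Omega, continuous (b i)}.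
Hypothesis b_L2 : forall i, L2 Omega (b i).
Hypothesis b_free : forall c : 'I_N -> R,
  agree (closure Omega) (lincomb b c) (fun=> 0) -> forall i, c i = 0.

Lemma lincomb_continuous c : {within closure Omega, continuous (lincomb b c)}.
Proof.
apply/subspace_continuousP => x cx.
suff : lincomb b c y @[y --> within (closure Omega) (nbhs x)] --> lincomb b c x by [].
rewrite /lincomb.
have bx i : b i y @[y --> within (closure Omega) (nbhs x)] --> b i x.
  by have /subspace_continuousP/(_ x cx) := @b_cont i.
elim: (index_enum _) => [|i s IH] /=.
  by under eq_fun do rewrite big_nil; rewrite big_nil; exact: cvg_cst.
under eq_fun do rewrite big_cons; rewrite big_cons.
by apply: cvgD => //; apply: cvgMr.
Qed.

Lemma lincomb_L2 c : L2 Omega (lincomb b c).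
Proof. exact: L2_lincomb. Qed.

Definition gram : 'M[R]_N := \matrix_(i, j) dotL2 Omega (b i) (b j).

Lemma dotL2_lincomb c v : L2 Omega v ->
  dotL2 Omega (lincomb b c) v = \sum_i c i * dotL2 Omega (b i) v.
Proof. by move=> Lv; rewrite /lincomb dotL2_lincombl. Qed.

(** A vector of the kernel of the Gram matrix is the coordinate vector of a
    combination of zero norm. *)
Lemma gram_unit : gram \in unitmx.
Proof.
rewrite unitmxE unitfE; apply/negP => /det0P[v v0 vG].
have vv0 : dotL2 Omega (lincomb b (v 0)) (lincomb b (v 0)) = 0.
  rewrite dotL2_lincomb; last exact: lincomb_L2.
  under eq_bigr => i _ do rewrite dotL2C dotL2_lincomb//.
  rewrite big1// => i _; have := congr1 (fun w : 'rV_N => w 0 i) vG; rewrite !mxE.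
  by under eq_bigr do rewrite mxE; move=> ->; rewrite mulr0.
move/eqP: v0; apply; apply/rowP => i; rewrite mxE; apply: b_free.
apply: dotL2_self_eq0 vv0; [exact: lincomb_continuous|exact: lincomb_L2].
Qed.

(** The coordinates are the image under the inverse Gram matrix of the scalar
    products with the basis. *)
Lemma cvg_coords (u : nat -> E -> R) (c : nat -> 'I_N -> R) (d : 'I_N -> R) :
  (forall k, agree (closure Omega) (u k) (lincomb b (c k))) ->
  (forall j, dotL2 Omega (u k) (b j) @[k --> \oo] --> d j) ->
  exists cl : 'I_N -> R, forall i, c k i @[k --> \oo] --> cl i.
Proof.
move=> uc ud; exists (fun i => \sum_j d j * invmx gram j i) => i.
have -> : (fun k => c k i) =
    fun k => \sum_j dotL2 Omega (u k) (b j) * invmx gram j i.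
  apply/funext => k.
  have : (\row_i c k i) *m gram = \row_j dotL2 Omega (u k) (b j).
    apply/rowP => j; rewrite !mxE.
    rewrite (@eq_dotL2 _ _ _ _ (lincomb b (c k)) _ (b j))//; last first.
      by move=> x Ox; apply: uc; exact: subset_closure.
    by rewrite dotL2_lincomb//; apply: eq_bigr => l _; rewrite !mxE.
  move=> /(congr1 (mulmx^~ (invmx gram))); rewrite (mulmxK gram_unit).
  move=> /rowP/(_ i); rewrite !mxE => ->.
  by apply: eq_bigr => j _; rewrite mxE.
by apply: cvg_sum => j; exact: cvgMl.
Qed.

(** The square of the norm of the difference is the Gram quadratic form of the
    differences of the coordinates. *)
Lemma cvgL2_lincomb (c : nat -> 'I_N -> R) (cl : 'I_N -> R) :
  (forall i, c k i @[k --> \oo] --> cl i) ->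
  cvgL2 Omega (fun k => lincomb b (c k)) (lincomb b cl).
Proof.
move=> ccl; rewrite /cvgL2 /normL2 -(@sqrtr0 R).
apply: continuous_cvg; first exact: sqrt_continuous.
have -> : (fun k => dotL2 Omega (lincomb b (c k) \- lincomb b cl)
             (lincomb b (c k) \- lincomb b cl)) =
    fun k => \sum_i (c k i - cl i) *
                (\sum_j (c k j - cl j) * dotL2 Omega (b j) (b i)).
  apply/funext => k.
  have e : agree Omega (lincomb b (c k) \- lincomb b cl) (lincomb b (fun i => c k i - cl i)).
    move=> x _; rewrite /lincomb /= -sumrB; apply: eq_bigr => i _.
    by rewrite mulrBl.
  rewrite (eq_dotL2 e e) dotL2_lincomb; last exact: lincomb_L2.
  by apply: eq_bigr => i _; rewrite dotL2C dotL2_lincomb.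
have z i : c k i - cl i @[k --> \oo] --> 0 by apply/subr_cvg0.
rewrite -[X in _ --> X](_ : \sum_(i < N) 0 * (\sum_j 0 * dotL2 Omega (b j) (b i)) = 0).
  by apply: cvg_sum => i; apply: cvgM => //; apply: cvg_sum => j; exact: cvgMl.
by rewrite big1// => i _; rewrite mul0r.
Qed.
End finite_dim.

(** * The nonlinear term and weak gradients *)

Section nonlinear.
Variables (R : realType) (n : nat) (Omega : set 'rV[R]_n).
Hypotheses (oO : open Omega) (bO : bounded_set Omega).
Local Notation mu := (@lebesgue_rV R n).
Local Notation E := ('rV[R]_n).

Let mO : measurable Omega := open_measurable_rV oO.
Let fO : (mu Omega < +oo)%E := lebesgue_rV_bounded mO bO.

(** A continuous function is bounded on the compact closure of Omega, and Omega
    has finite measure. *)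
Lemma L2_continuous (u : E -> R) : continuous u -> L2 Omega u.
Proof.
move=> cu; apply: L2_bounded => //; first exact: continuous_measurable_rV.
have [M uM] := continuous_closure_bounded bO (continuous_subspaceT cu).
by exists M => x /subset_closure; exact: uM.
Qed.

(** Constants are square integrable since Omega has finite measure. *)
Lemma L2_integrable (u : E -> R) : L2 Omega u -> mu.-integrable Omega (EFin \o u).
Proof.
move=> Lu; have L1 : L2 Omega (fun=> 1) by apply: L2_continuous; exact: cst_continuous.
apply: eq_integrable (L2_integrableM mO Lu L1) => // x _ /=.
by rewrite mulr1.
Qed.

Variables (N : nat) (b : 'I_N -> E -> R).
Hypothesis b_cont : forall i, {within closure Omega, continuous (b i)}.
Hypothesis b_L2 : forall i, L2 Omega (b i).

Lemma continuous_bounded_on_itv (f : R -> R) (K : R) : continuous f ->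
  exists M, forall y, `|y| <= K -> `|f y| <= M.
Proof.
move=> cf; have /compact_bounded[M [Mr H]] :=
  continuous_compact (continuous_subspaceT cf) (@segment_compact _ (- K) K).
exists (`|M| + 1) => y yK; apply: (H (`|M| + 1)).
  by rewrite (le_lt_trans (ler_norm M))// ltrDl.
by exists y => //; rewrite /= in_itv /= -ler_norml.
Qed.

Lemma L2_comp (f : R -> R) (u : E -> R) : continuous f ->
  {within closure Omega, continuous u} -> L2 Omega u ->
  L2 Omega (fun x => f (u x)).
Proof.
move=> cf cu [mu_ _]; have [K uK] := continuous_closure_bounded bO cu.
have [M fM] := continuous_bounded_on_itv K cf.
apply: L2_bounded => //.
  by apply: measurableT_comp mu_; exact: continuous_measurable_fun.
by exists M => x Ox; apply/fM/uK; exact: subset_closure.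
Qed.

(** The values of the combinations stay in a fixed interval, on which f is
    bounded, so a multiple of |v| dominates. *)
Lemma cvg_dotL2_comp_lincomb (f : R -> R) (v : E -> R)
    (c : nat -> 'I_N -> R) (cl : 'I_N -> R) :
  continuous f -> L2 Omega v -> (forall i, c k i @[k --> \oo] --> cl i) ->
  dotL2 Omega (fun x => f (lincomb b (c k) x)) v @[k --> \oo] -->
  dotL2 Omega (fun x => f (lincomb b cl x)) v.
Proof.
move=> cf Lv ccl.
have Lf a : L2 Omega (fun x => f (lincomb b a x)).
  by apply: L2_comp => //; [exact: lincomb_continuous|exact: lincomb_L2].
have /choice[B bB] i := continuous_closure_bounded bO (@b_cont i).
have /choice[C cC] i : exists M, forall k, `|c k i| <= M.
  have : cvgn (fun k => c k i) by apply/cvg_ex; exists (cl i); exact: ccl.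
  move=> /cvg_seq_bounded[M [Mr H]]; exists (`|M| + 1) => k.
  by apply: H => //; rewrite (le_lt_trans (ler_norm M))// ltrDl.
(* a common bound on the values of all the combinations *)
pose K := \sum_i C i * B i.
have lK k x : Omega x -> `|lincomb b (c k) x| <= K.
  move=> Ox.
  apply: le_trans (ler_norm_sum _ _ _) _; apply: ler_sum => i _.
  by rewrite normrM ler_pM// bB//; exact: subset_closure.
have [M fM] := continuous_bounded_on_itv K cf.
have := @dominated_cvg _ _ _ mu Omega mO
  (fun k x => (f (lincomb b (c k) x) * v x)%:E)
  (fun x => (f (lincomb b cl x) * v x)%:E) (fun x => (M%:E * `|v x|%:E)%E).
move=> H; apply: fine_cvg; rewrite /Rintegral fineK; last first.
  by apply: integrable_fin_num => //; exact: L2_integrableM.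
apply: H.
- by move=> k; apply/measurable_EFinP; apply: measurable_funM; [case: (Lf (c k))|case: Lv].
- move=> x Ox; apply: cvg_EFin; first by near=> k.
  apply: cvgMl; apply: continuous_cvg; first exact: cf.
  by rewrite /lincomb; apply: cvg_sum => i; exact: cvgMl.
- by [].
- apply: integrableZl => //.
  exact: integrable_norm (L2_integrable Lv).
- move=> k x Ox; rewrite lee_fin normrM ler_wpM2r// fM//; exact: lK.
Unshelve. all: by end_near.
Qed.
End nonlinear.

Section gradient.
Variables (R : realType) (n : nat) (Omega : set 'rV[R]_n).
Hypotheses (oO : open Omega) (bO : bounded_set Omega).
Local Notation E := ('rV[R]_n).
Implicit Types (u v : E -> R) (g h : E -> E).
Let mO : measurable Omega := open_measurable_rV oO.

Lemma test_function_L2 phi : test_function Omega phi -> L2 Omega phi.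
Proof.
move=> [sphi _]; apply: L2_continuous => // x.
exact: differentiable_continuous (sphi [::] x).
Qed.

Lemma test_function_partial_L2 i phi : test_function Omega phi ->
  L2 Omega (partial i phi).
Proof.
move=> [sphi _]; apply: L2_continuous => // x.
exact: differentiable_continuous (sphi [:: i] x).
Qed.

Lemma dotL2_vecE g h : (forall i, L2 Omega (fun x => g x ord0 i)) ->
  (forall i, L2 Omega (fun x => h x ord0 i)) ->
  dotL2_vec Omega g h =
  \sum_i dotL2 Omega (fun x => g x ord0 i) (fun x => h x ord0 i).
Proof.
move=> Lg Lh; rewrite /dotL2_vec.
elim: (index_enum _) => [|i s IH].
  by under eq_fun do rewrite big_nil; rewrite big_nil Rintegral_cst// mul0r.
under eq_fun do rewrite big_cons.
rewrite big_cons RintegralD//; [by rewrite IH|exact: L2_integrableM|].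
elim: s {IH} => [|j s IH].
  by under eq_fun do rewrite big_nil; exact: integrable0.
under eq_fun do rewrite big_cons.
exact: (integrableD mO (L2_integrableM mO (Lg j) (Lh j)) IH).
Qed.

Lemma dotL2_vec_linl (a : R) g g' h : (forall i, L2 Omega (fun x => g x ord0 i)) ->
  (forall i, L2 Omega (fun x => g' x ord0 i)) ->
  (forall i, L2 Omega (fun x => h x ord0 i)) ->
  dotL2_vec Omega (fun x => a *: g x + g' x) h =
  a * dotL2_vec Omega g h + dotL2_vec Omega g' h.
Proof.
move=> Lg Lg' Lh.
have e i : (fun x => (a *: g x + g' x) ord0 i) = fun x => a * g x ord0 i + g' x ord0 i.
  by apply/funext => x; rewrite !mxE.
rewrite !dotL2_vecE//; last by move=> i; rewrite e; exact: L2_lin.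
rewrite mulr_sumr -big_split; apply: eq_bigr => i _ /=.
by rewrite e dotL2_linl.
Qed.

Lemma weak_gradient_lin (a : R) u v g h : L2 Omega u -> L2 Omega v ->
  weak_gradient Omega u g -> weak_gradient Omega v h ->
  weak_gradient Omega (fun x => a * u x + v x) (fun x => a *: g x + h x).
Proof.
move=> Lu Lv [Lg ug] [Lh vh].
have e i : (fun x => (a *: g x + h x) ord0 i) = fun x => a * g x ord0 i + h x ord0 i.
  by apply/funext => x; rewrite !mxE.
split=> [i|phi tphi i]; first by rewrite e; exact: L2_lin.
have Lphi := test_function_L2 tphi; have Lpphi := test_function_partial_L2 i tphi.
by rewrite e !dotL2_linl// ug// vh// mulrN opprD.
Qed.

Lemma weak_gradient_0 : weak_gradient Omega (fun=> 0) (fun=> 0).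
Proof.
have e (i : 'I_n) : (fun x : E => (0 : E) ord0 i) = fun=> 0 :> R.
  by apply/funext => x; rewrite mxE.
by split=> [i|phi _ i]; rewrite e; [exact: L2_0|rewrite !dotL2_0l ?oppr0].
Qed.

Lemma weak_gradient_lincomb (N : nat) (b : 'I_N -> E -> R) (gb : 'I_N -> E -> E)
    (c : 'I_N -> R) :
  (forall i, L2 Omega (b i)) -> (forall i, weak_gradient Omega (b i) (gb i)) ->
  weak_gradient Omega (lincomb b c) (fun x => \sum_i c i *: gb i x).
Proof.
move=> Lb bgb; rewrite /lincomb; elim: (index_enum _) => [|i s IH].
  under eq_fun do rewrite big_nil.
  by under [X in weak_gradient _ _ X]eq_fun do rewrite big_nil; exact: weak_gradient_0.
under eq_fun do rewrite big_cons.
under [X in weak_gradient _ _ X]eq_fun do rewrite big_cons.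
by apply: weak_gradient_lin => //; exact: L2_lincomb.
Qed.

Lemma dotL2_vec_lincombl (N : nat) (gb : 'I_N -> E -> E) (c : 'I_N -> R) h :
  (forall j i, L2 Omega (fun x => gb j x ord0 i)) ->
  (forall i, L2 Omega (fun x => h x ord0 i)) ->
  dotL2_vec Omega (fun x => \sum_j c j *: gb j x) h =
  \sum_j c j * dotL2_vec Omega (gb j) h.
Proof.
move=> Lgb Lh; elim: (index_enum _) => [|j s IH].
  under eq_fun do rewrite big_nil.
  rewrite big_nil dotL2_vecE//; last first.
    by move=> i; under eq_fun do rewrite mxE; exact: L2_0.
  by rewrite big1// => i _; under eq_fun do rewrite mxE; exact: dotL2_0l.
under eq_fun do rewrite big_cons.
rewrite big_cons dotL2_vec_linl ?IH// => i.
under eq_fun do rewrite summxE; under eq_fun do under eq_bigr do rewrite mxE.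
exact: L2_lincomb.
Qed.

Lemma eq_weak_gradient u v g : agree Omega u v ->
  weak_gradient Omega u g -> weak_gradient Omega v g.
Proof.
move=> uv [Lg ug]; split=> // phi tphi i; rewrite -ug//.
by apply: eq_dotL2 => // x Ox; rewrite uv.
Qed.
End gradient.

(** * The limit of the correction step *)

(** Unfolds a finite element space into the form used to pass to the limit: a
    basis together with a choice of gradients of its elements. *)
Lemma fe_space_basis (R : realType) (n : nat) (Omega : set 'rV[R]_n) (N : nat)
    (V : set ('rV[R]_n -> R)) : fe_space Omega N V ->
  exists (b : 'I_N -> 'rV[R]_n -> R) (gb : 'I_N -> 'rV[R]_n -> 'rV[R]_n),
  [/\ forall i, V (b i),
      forall i, weak_gradient Omega (b i) (gb i),
      forall c, agree (closure Omega) (lincomb b c) (fun=> 0) ->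
        forall i, c i = 0 &
      forall u, V u <-> exists c, agree (closure Omega) u (lincomb b c)].
Proof.
move=> V_fe; have [b [b_free VE]] := fe_basis V_fe.
have bV i : V (b i).
  apply/VE; exists (fun j => (j == i)%:R) => x _.
  by rewrite (bigD1 i)//= eqxx mul1r big1 ?addr0// => j /negPf ->; rewrite mul0r.
have /choice[gb bgb] i : exists g, weak_gradient Omega (b i) g.
  by have [] := fe_H1 V_fe (bV i).
by exists b, gb.
Qed.

Section bigrid_limit.
Variables (R : realType) (n : nat) (Omega : set 'rV[R]_n).
Hypotheses (Omega_open : open Omega) (Omega_bounded : bounded_set Omega).
Local Notation E := ('rV[R]_n).
Variables (f F : R -> R) (N : nat) (W V : set ('rV[R]_n -> R)) (dt tau : R).
Hypotheses (V_fe : fe_space Omega N V) (dt_gt0 : 0 < dt).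
Variables (uH ut z uh : nat -> 'rV[R]_n -> R).
Hypothesis scheme : bigrid_scheme f F Omega W V dt tau uH ut z uh.

Let mO : measurable Omega := open_measurable_rV Omega_open.

(** Adding to a gradient gz of z^1 the difference d of the two versions gives
    another gradient of z^1; comparing the correction step for both leaves
    dt (d, grad phi) = 0. *)
Lemma weak_gradient_version u g g' phi gphi :
  L2 Omega u -> weak_gradient Omega u g -> weak_gradient Omega u g' ->
  V phi -> weak_gradient Omega phi gphi ->
  dotL2_vec Omega g gphi = dotL2_vec Omega g' gphi.
Proof.
move=> Lu ug ug' Vphi phig.
have [Lz [gz zg]] := fe_H1 V_fe (bigrid_z_in scheme 1).
have [Lt [gt tg]] := fe_H1 V_fe (bigrid_ut_in scheme 1).
pose d x := -1 *: g' x + g x.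
have dg : weak_gradient Omega (fun x => -1 * u x + u x) d by exact: weak_gradient_lin.
have zg' : weak_gradient Omega (z 1%N) (fun x => 1 *: d x + gz x).
  have := weak_gradient_lin Omega_open Omega_bounded 1 (L2_lin mO (-1) Lu Lu) Lz dg zg.
  by apply: eq_weak_gradient => x _; rewrite mulN1r addNr mulr0 add0r.
have e1 := bigrid_correction scheme Vphi zg tg phig.
have e2 := bigrid_correction scheme Vphi zg' tg phig.
have [[Lg _] [Lg' _] [Ld _] [Lgz _] [Lphi _]] := And5 ug ug' dg zg phig.
move: e2; rewrite (dotL2_vec_linl Omega_open)// (dotL2_vec_linl Omega_open)// => e2.
have : dt * (dotL2_vec Omega g gphi - dotL2_vec Omega g' gphi) = 0 by lra.
by move/eqP; rewrite mulf_eq0 gt_eqF//= subr_eq0 => /eqP.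
Qed.

Hypothesis f_cont : continuous f.
Variables (b : 'I_N -> E -> R) (gb : 'I_N -> E -> E).
Hypothesis b_cont : forall i, {within closure Omega, continuous (b i)}.
Hypothesis b_L2 : forall i, L2 Omega (b i).
Hypothesis b_grad : forall i, weak_gradient Omega (b i) (gb i).
Hypothesis VE : forall u, V u <-> exists c, agree (closure Omega) u (lincomb b c).
Variables a d : nat -> 'I_N -> R.
Hypothesis z_coords : forall k, agree (closure Omega) (z k) (lincomb b (a k)).
Hypothesis ut_coords : forall k, agree (closure Omega) (ut k) (lincomb b (d k)).

Let V_L2 u : V u -> L2 Omega u.
Proof. by move=> /(fe_H1 V_fe)[]. Qed.

Let b_grad_L2 j i : L2 Omega (fun x => gb j x ord0 i).
Proof. by have [] := b_grad j. Qed.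

Let wg c : weak_gradient Omega (lincomb b c) (fun x => \sum_i c i *: gb i x).
Proof. exact: weak_gradient_lincomb. Qed.

Lemma agree_closure u v : agree (closure Omega) u v -> agree Omega u v.
Proof. by move=> uv x Ox; apply: uv; exact: subset_closure. Qed.

Lemma uh_coords k :
  agree (closure Omega) (uh k) (lincomb b (fun i => a k i + d k i)).
Proof.
move=> x cx; rewrite (bigrid_u scheme)//= z_coords// ut_coords// addrC -big_split.
by apply: eq_bigr => i _ /=; rewrite mulrDl.
Qed.

Section fixed_test_function.
Variables (phi : E -> R) (gphi : E -> E).
Hypotheses (Vphi : V phi) (phig : weak_gradient Omega phi gphi).

(** The coordinate forms of the scalar products with the test function of,
    respectively, the gradient of an element of V (S as stiffness), the element
    itself (P as projection), and its image under f. *)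
Let S (c : 'I_N -> R) := \sum_i c i * dotL2_vec Omega (gb i) gphi.
Let P (c : 'I_N -> R) := \sum_i c i * dotL2 Omega (b i) phi.
Let Phi (c : 'I_N -> R) := dotL2 Omega (fun x => f (lincomb b c x)) phi.

Lemma correction_coords k :
  (1 + tau * dt) * (P (a k.+1) - P (a k)) + dt * S (a k.+1) +
  dt * S (d k.+1) + (P (d k.+1) - P (d k)) +
  dt * Phi (fun i => a k i + d k i) = 0.
Proof.
have [Lgphi _] := phig; have Lphi := V_L2 Vphi.
have zO j := agree_closure (@z_coords j); have utO j := agree_closure (@ut_coords j).
have zg : weak_gradient Omega (z k.+1) (fun x => \sum_i a k.+1 i *: gb i x).
  by apply: eq_weak_gradient (wg _) => x Ox; rewrite zO.
have tg : weak_gradient Omega (ut k.+1) (fun x => \sum_i d k.+1 i *: gb i x).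
  by apply: eq_weak_gradient (wg _) => x Ox; rewrite utO.
have Lz j : L2 Omega (z j) by exact/V_L2/(bigrid_z_in scheme).
have Lut j : L2 Omega (ut j) by exact/V_L2/(bigrid_ut_in scheme).
have PE u c : agree Omega u (lincomb b c) -> dotL2 Omega u phi = P c.
  move=> uc; rewrite (eq_dotL2 uc (fun x _ => erefl (phi x))).
  by rewrite (dotL2_lincomb Omega_open).
have := bigrid_correction scheme Vphi zg tg phig.
rewrite !(dotL2_vec_lincombl Omega_open)// !dotL2Bl//.
rewrite !(PE (z _) _ (zO _)) !(PE (ut _) _ (utO _)).
rewrite (@eq_dotL2 _ _ _ _ (fun x => f (lincomb b (fun i => a k i + d k i) x)) phi phi)//.
by move=> x Ox; rewrite (agree_closure (@uh_coords k)).
Qed.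

(** The terms in P cancel in the limit, and the two terms in S add up. *)
Lemma correction_limit (al dl : 'I_N -> R) :
  (forall i, a k i @[k --> \oo] --> al i) ->
  (forall i, d k i @[k --> \oo] --> dl i) ->
  S (fun i => al i + dl i) + Phi (fun i => al i + dl i) = 0.
Proof.
move=> aal ddl.
have lim_lin (s : 'I_N -> R) (c : nat -> 'I_N -> R) (cl : 'I_N -> R) :
    (forall i, c k i @[k --> \oo] --> cl i) ->
    \sum_i c k i * s i @[k --> \oo] --> \sum_i cl i * s i.
  by move=> ccl; apply: cvg_sum => i; exact: cvgMl.
have shift (c : nat -> 'I_N -> R) (cl : 'I_N -> R) :
    (forall i, c k i @[k --> \oo] --> cl i) ->
    forall i, c k.+1 i @[k --> \oo] --> cl i.
  by move=> ccl i; rewrite (cvg_shiftS (fun k => c k i)); exact: ccl.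
have : (1 + tau * dt) * (P al - P al) + dt * S al + dt * S dl + (P dl - P dl) +
    dt * Phi (fun i => al i + dl i) = 0.
  have step0 : (fun k => (1 + tau * dt) * (P (a k.+1) - P (a k)) +
      dt * S (a k.+1) + dt * S (d k.+1) + (P (d k.+1) - P (d k)) +
      dt * Phi (fun i => a k i + d k i)) @ \oo --> (0 : R).
    rewrite (_ : (fun _ => _) = cst 0); first exact: cvg_cst.
    by apply/funext => k; exact: correction_coords.
  apply/esym/(cvg_unique _ step0) => //.
  have la := lim_lin _ _ _ aal; have la1 := lim_lin _ _ _ (shift _ _ aal).
  have ld := lim_lin _ _ _ ddl; have ld1 := lim_lin _ _ _ (shift _ _ ddl).
  apply: cvgD; last first.
    apply: cvgMr; apply: cvg_dotL2_comp_lincomb => //; first exact: V_L2.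
    by move=> i; exact: cvgD.
  apply: cvgD; last by apply: cvgB; [exact: ld1|exact: ld].
  apply: cvgD; last by apply: cvgMr; exact: ld1.
  apply: cvgD; last by apply: cvgMr; exact: la1.
  by apply: cvgMr; apply: cvgB; [exact: la1|exact: la].
have -> : S (fun i => al i + dl i) = S al + S dl.
  by rewrite /S -big_split; apply: eq_bigr => i _ /=; rewrite mulrDl.
rewrite !subrr mulr0 add0r addr0 -!mulrDr => /eqP.
by rewrite mulf_eq0 gt_eqF//= => /eqP.
Qed.

End fixed_test_function.

Lemma limit_stationary (al dl : 'I_N -> R) :
  (forall i, a k i @[k --> \oo] --> al i) ->
  (forall i, d k i @[k --> \oo] --> dl i) ->
  stationary f Omega V (lincomb b (fun i => al i + dl i)).
Proof.
move=> aal ddl; split; first by apply/VE; eexists.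
move=> phi Vphi gu gphi ug phig; have [Lgphi _] := phig.
have Lul : L2 Omega (lincomb b (fun i => al i + dl i)) by exact: lincomb_L2.
rewrite (weak_gradient_version Lul ug (wg _) Vphi phig) (dotL2_vec_lincombl Omega_open)//.
exact: correction_limit.
Qed.

End bigrid_limit.

(** * Convergence to the stationary state *)

Unset Implicit Arguments.

Theorem proposition3p5 (R : realType) (n : nat) (Omega : set 'rV[R]_n)
  (Omega_open : open Omega) (Omega_bounded : bounded_set Omega)
  (F f : R -> R)
  (F_deriv : forall x : R, is_derive x 1 F (f x))
  (f_derivable : forall x : R, derivable f x 1)
  (M N : nat) (W V : set ('rV[R]_n -> R))
  (W_fe : fe_space Omega M W) (V_fe : fe_space Omega N V) (MN : (M < N)%N)
  (dt tau : R) (dt_gt0 : 0 < dt) (tau_gt0 : 0 < tau)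
  (ubarH ubarh : 'rV[R]_n -> R)
  (ubarH_stationary : stationary f Omega W ubarH)
  (ubarh_stationary : stationary f Omega V ubarh)
  (ubar_unique : forall vH vh : 'rV[R]_n -> R,
     stationary f Omega W vH -> stationary f Omega V vh ->
     agree (closure Omega) vH ubarH /\ agree (closure Omega) vh ubarh)
  (uH ut z uh : nat -> 'rV[R]_n -> R)
  (scheme : bigrid_scheme f F Omega W V dt tau uH ut z uh)
  (uH_cvg : cvgL2 Omega uH ubarH)
  (zbar : 'rV[R]_n -> R) (zbar_in : V zbar)
  (z_cvg : cvgL2 Omega z zbar) :
  cvgL2 Omega uh ubarh.
Proof.
have mO := open_measurable_rV Omega_open.
have [b [gb [bV b_grad b_free VE]]] := fe_space_basis V_fe.
have L2W u : W u -> L2 Omega u by move=> /(fe_H1 W_fe)[].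
have L2V u : V u -> L2 Omega u by move=> /(fe_H1 V_fe)[].
have b_cont i := @fe_continuous _ _ _ _ _ V_fe _ (bV i).
have b_L2 i := L2V _ (bV i).
have /choice[a za] k := (VE _).1 (bigrid_z_in scheme k).
have /choice[d td] k := (VE _).1 (bigrid_ut_in scheme k).
have [al aal] : exists al : 'I_N -> R, forall i, a k i @[k --> \oo] --> al i.
  apply: (cvg_coords Omega_open b_cont b_L2 b_free za) => j.
  apply: (cvgL2_dotL2 mO _ _ (b_L2 j) z_cvg); last exact: L2V.
  by move=> k; exact/L2V/(bigrid_z_in scheme).
have [dl ddl] : exists dl : 'I_N -> R, forall i, d k i @[k --> \oo] --> dl i.
  (* ut 0 is arbitrary, hence the shift by one *)
  have [k|j|dl H] := @cvg_coords _ _ _ Omega_open _ _ b_cont b_L2 b_free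
    (fun k => ut k.+1) (fun k => d k.+1) (fun j => dotL2 Omega ubarH (b j)).
  - exact: td.
  - have -> : (fun k => dotL2 Omega (ut k.+1) (b j)) =
        (fun k => dotL2 Omega (uH k.+1) (b j)).
      apply/funext => k; apply/eqP; rewrite -subr_eq0.
      by rewrite (bigrid_prolongation scheme).
    rewrite (cvg_shiftS (fun k => dotL2 Omega (uH k) (b j))).
    apply: (cvgL2_dotL2 mO _ _ (b_L2 j) uH_cvg).
      by move=> k; exact/L2W/(bigrid_uH_in scheme).
    by apply/L2W; case: ubarH_stationary.
  - by exists dl => i; rewrite -(cvg_shiftS (fun k => d k i)); exact: H.
have cf : continuous f.
  by move=> x; apply: differentiable_continuous; apply/derivable1_diffP.
have ul_stat := limit_stationary Omega_open Omega_bounded V_fe dt_gt0 scheme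
  cf b_cont b_L2 b_grad VE za td aal ddl.
have [_ ulE] := ubar_unique _ _ ubarH_stationary ul_stat.
have cdl i : a k i + d k i @[k --> \oo] --> al i + dl i by exact: cvgD.
rewrite /cvgL2 (_ : (fun _ => _) = fun k =>
    normL2 Omega (lincomb b (fun i => a k i + d k i) \-
                  lincomb b (fun i => al i + dl i))).
  exact: cvgL2_lincomb.
apply/funext => k; congr Num.sqrt.
by apply: eq_dotL2 => x /subset_closure cx /=; rewrite (uh_coords scheme za td)// -ulE.
Qed.
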